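(* Let $g$ be an axisymmetric metric with cylindrical coordinates $(\rho,z,\phi)$, let $\delta_{\mathbb{R}^3}$ be the flat metric in these cylindrical coordinates, and let $\Sigma$ be a $C^1$ axisymmetric surface. If $g$ is area enlarging, then $$\mathrm{Area}_g(\Sigma)\ge \mathrm{Area}_{\delta_{\mathbb{R}^3}}(\Sigma).$$
   Context: An axisymmetric metric is a smooth Riemannian metric given in global cylindrical coordinates $(\rho,z,\phi)$ by $g=e^{2\alpha-2u}(d\rho^2+dz^2)+\rho^2e^{-2u}(d\phi+B\,d\rho+A\,dz)^2$, where $\alpha,u,A,B$ depend only on $(\rho,z)$; its Killing field is $\eta=\partial/\partial\phi$. The flat metric is $\delta_{\mathbb{R}^3}=d\rho^2+dz^2+\rho^2d\phi^2$. A $C^1$ axisymmetric surface is one obtained by rotating (in $\phi$) a $C^1$ curve in the $(\rho,z)$ half-plane. The metric $g$ is area enlarging if $\frac{|\eta|_g}{|\nabla\rho|_g}(\rho_0,z)\ge\rho_0$ for every $\rho_0>0$ and all $z$; equivalently $\alpha-2u\ge0$ everywhere. *)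

(* Defs.v *)
From HB Require Import structures.
From mathcomp Require Import all_boot all_order all_algebra.
From mathcomp Require Import all_classical all_reals all_analysis.
From mathcomp Require Import ring.
Set Implicit Arguments.
Unset Strict Implicit.
Unset Printing Implicit Defensive.
Import Order.TTheory GRing.Theory Num.Theory numFieldNormedType.Exports.
Local Open Scope classical_set_scope.
Local Open Scope ring_scope.

Definition partial (R : realType) (n : nat) (i : 'I_n.+1)
    (f : 'rV[R]_n.+1 -> R) : 'rV[R]_n.+1 -> R :=
  fun p => 'D_(delta_mx 0 i) f p.

Fixpoint Ck (R : realType) (n k : nat) (f : 'rV[R]_n.+1 -> R) : Prop :=
  continuous f /\
  match k with
  | 0 => True
  | k'.+1 => forall i, (forall p, derivable f p (delta_mx 0 i)) /\
                       Ck k' (partial i f)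
  end.

Definition smooth (R : realType) (n : nat) (f : 'rV[R]_n.+1 -> R) : Prop :=
  forall k, Ck k f.

Definition bilin (R : realType) (n : nat) (G : 'M[R]_n) (v w : 'rV[R]_n) : R :=
  (v *m G *m w^T) 0 0.

(* [riemannian_metric R n] is a metric on R^(n+1), so dimension 3 is [n = 2]. *)
Record riemannian_metric (R : realType) (n : nat) := RiemannianMetric {
  metric_mx :> 'rV[R]_n.+1 -> 'M[R]_n.+1;
  metric_smooth : forall i j, smooth (fun p => metric_mx p i j);
  metric_sym : forall p, (metric_mx p)^T = metric_mx p;
  metric_pos : forall p v, v != 0 -> 0 < bilin (metric_mx p) v v
}.

Definition gnorm (R : realType) (n : nat) (g : riemannian_metric R n)
    (p v : 'rV[R]_n.+1) : R :=
  Num.sqrt (bilin (g p) v v).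

(* Row-vector convention: [gradient g f p] is the vector [X] such that
   [bilin (g p) X v] is the differential of [f] at [p] applied to [v]. *)
Definition gradient (R : realType) (n : nat) (g : riemannian_metric R n)
    (f : 'rV[R]_n.+1 -> R) (p : 'rV[R]_n.+1) : 'rV[R]_n.+1 :=
  (\row_i partial i f p) *m invmx (g p).

Definition vec3 (R : realType) (a b c : R) : 'rV[R]_3 :=
  \row_(i < 3) [:: a; b; c]`_i.

Definition cyl (R : realType) (rho z phi : R) : 'rV[R]_3 :=
  vec3 (rho * cos phi) (rho * sin phi) z.

(* The vector at [cyl rho z phi] with components [(a, b, c)] in the frame of
   the partial derivatives of [cyl] with respect to rho, z and phi. *)
Definition cyl_vec (R : realType) (rho phi a b c : R) : 'rV[R]_3 :=
  a *: vec3 (cos phi) (sin phi) 0 + b *: vec3 0 0 1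
  + c *: vec3 (- (rho * sin phi)) (rho * cos phi) 0.

Lemma is_derive_cyl (R : realType) (r z ph : R -> R) (t a b c : R) (i : 'I_3) :
  is_derive t 1 r a -> is_derive t 1 z b -> is_derive t 1 ph c ->
  is_derive t 1 (fun s => cyl (r s) (z s) (ph s) 0 i)
    (cyl_vec (r t) (ph t) a b c 0 i).
Proof.
move=> hr hz hph.
have hc : is_derive t 1 (cos \o ph) (- sin (ph t) * c).
  exact: is_derive1_comp.
have hs : is_derive t 1 (sin \o ph) (cos (ph t) * c).
  exact: is_derive1_comp.
have h1 := is_deriveM hr hc; have h2 := is_deriveM hr hs.
case: i => [[|[|[|//]]] hi].
- rewrite [X in is_derive _ _ X _](_ : _ = r * (cos \o ph)); last first.
    by apply/funext => s; rewrite mxE.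
  by apply: is_derive_eq; rewrite !mxE /= /GRing.scale /=; ring.
- rewrite [X in is_derive _ _ X _](_ : _ = r * (sin \o ph)); last first.
    by apply/funext => s; rewrite mxE.
  by apply: is_derive_eq; rewrite !mxE /= /GRing.scale /=; ring.
- rewrite [X in is_derive _ _ X _](_ : _ = z); last first.
    by apply/funext => s; rewrite mxE.
  by apply: is_derive_eq; rewrite !mxE /=; ring.
Qed.

Definition rho_fun (R : realType) (p : 'rV[R]_3) : R :=
  Num.sqrt (p 0 0 ^+ 2 + p 0 1 ^+ 2).

(* The field d/dphi in Cartesian components. *)
Definition eta (R : realType) (p : 'rV[R]_3) : 'rV[R]_3 :=
  vec3 (- p 0 1) (p 0 0) 0.

Lemma eta_cyl (R : realType) (rho z phi : R) :
  eta (cyl rho z phi) = cyl_vec rho phi 0 0 1.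
Proof. by apply/rowP => -[[|[|[|//]]] hi]; rewrite !mxE /=; ring. Qed.

(* The metric lives on all of R^3, hence is smooth across the axis; its
   cylindrical expression is required off the axis, where the coordinates are
   nondegenerate.  There it forces [m_alpha], [m_u], [m_A] and [m_B] to be
   smooth; their values at [rho <= 0] are irrelevant. *)
Record axisym_metric (R : realType) := AxisymMetric {
  axisym_riem :> riemannian_metric R 2;
  m_alpha : R -> R -> R;
  m_u : R -> R -> R;
  m_A : R -> R -> R;
  m_B : R -> R -> R;
  axisym_line_element : forall rho z phi a b c : R, 0 < rho ->
    bilin (axisym_riem (cyl rho z phi))
      (cyl_vec rho phi a b c) (cyl_vec rho phi a b c) =
    expR (2 * m_alpha rho z - 2 * m_u rho z) * (a ^+ 2 + b ^+ 2)
    + rho ^+ 2 * expR (- 2 * m_u rho z)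
      * (c + m_B rho z * a + m_A rho z * b) ^+ 2
}.

Definition area_enlarging (R : realType) (g : axisym_metric R) : Prop :=
  forall rho0 z phi : R, 0 < rho0 ->
    let p := cyl rho0 z phi in
    rho0 <= gnorm g p (eta p) / gnorm g p (gradient g (@rho_fun R) p).

Lemma Ck_cst (R : realType) (n k : nat) (c : R) :
  Ck k (fun _ : 'rV[R]_n.+1 => c).
Proof.
elim: k c => [|k IH] c /=; split => //; try exact: cst_continuous.
move=> i; split=> [p|]; first exact: derivable_cst.
rewrite (_ : partial i _ = fun=> 0); first exact: IH.
by apply/funext => p; rewrite /partial derive_cst.
Qed.

Lemma id_metric_pos (R : realType) (n : nat) (v : 'rV[R]_n.+1) :
  v != 0 -> 0 < bilin 1%:M v v.
Proof.
move=> v0; rewrite /bilin mulmx1 mxE lt0r; apply/andP; split; last first.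
  by apply: sumr_ge0 => i _; rewrite mxE -expr2 sqr_ge0.
apply: contra v0; rewrite psumr_eq0 => [/allP h|i _]; last first.
  by rewrite mxE -expr2 sqr_ge0.
apply/eqP/rowP => i; have := h i (mem_index_enum i).
by rewrite /= !mxE -expr2 sqrf_eq0 => /eqP.
Qed.

Definition euclidean_metric (R : realType) (n : nat) : riemannian_metric R n :=
  @RiemannianMetric R n (fun=> 1%:M) (fun i j k => Ck_cst n k _)
    (fun=> trmx1 _ _) (fun=> @id_metric_pos R n).

Lemma flat_line_element (R : realType) (rho z phi a b c : R) : 0 < rho ->
  bilin (euclidean_metric R 2 (cyl rho z phi))
    (cyl_vec rho phi a b c) (cyl_vec rho phi a b c) =
  expR (2 * 0 - 2 * 0) * (a ^+ 2 + b ^+ 2)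
  + rho ^+ 2 * expR (- 2 * 0) * (c + 0 * a + 0 * b) ^+ 2.
Proof.
move=> _; rewrite /bilin /= mulmx1 !mulr0 subr0 expR0 mxE !big_ord_recr.
rewrite big_ord0 !mxE /=.
have h := cos2Dsin2 phi.
transitivity ((a ^+ 2 + (rho * c) ^+ 2) * (cos phi ^+ 2 + sin phi ^+ 2)
  + b ^+ 2); first by ring.
by rewrite h; ring.
Qed.

Definition flat_metric (R : realType) : axisym_metric R :=
  @AxisymMetric R (euclidean_metric R 2) (fun _ _ => 0) (fun _ _ => 0)
    (fun _ _ => 0) (fun _ _ => 0) (@flat_line_element R).

(* [f] is C^1 on the interval [I] with derivative [f'], one-sided at the
   endpoints that belong to [I]. *)
Definition C1_on (R : realType) (I : interval R) (f f' : R -> R) : Prop :=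
  (forall t, t \in I ->
     (f s - f t) / (s - t) @[s --> within [set` I] t^'] --> f' t) /\
  {within [set` I], continuous f'}.

(* A C^1 curve [t |-> (c_rho t, c_z t)] in the half-plane [rho >= 0], together
   with its velocity; it generates the surface
   [(t, phi) |-> cyl (c_rho t) (c_z t) phi]. *)
Record C1_axisym_surface (R : realType) := C1AxisymSurface {
  c_dom : interval R;
  c_rho : R -> R;
  c_z : R -> R;
  c_drho : R -> R;
  c_dz : R -> R;
  c_half_plane : forall t, t \in c_dom -> 0 <= c_rho t;
  c_rho_C1 : C1_on c_dom c_rho c_drho;
  c_z_C1 : C1_on c_dom c_z c_dz
}.

Definition area_density (R : realType) (g : riemannian_metric R 2)
    (S : C1_axisym_surface R) (t phi : R) : R :=
  let G := g (cyl (c_rho S t) (c_z S t) phi) in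
  let St := cyl_vec (c_rho S t) phi (c_drho S t) (c_dz S t) 0 in
  let Sphi := cyl_vec (c_rho S t) phi 0 0 1 in
  Num.sqrt (bilin G St St * bilin G Sphi Sphi - bilin G St Sphi ^+ 2).

(* Possibly infinite, when [c_dom S] is not compact. *)
Definition area (R : realType) (g : riemannian_metric R 2)
    (S : C1_axisym_surface R) : \bar R :=
  (\int[(@lebesgue_measure R \x @lebesgue_measure R)%E]_(x in
      [set` c_dom S] `*` `[0%R, (2 * pi)%R]) (area_density g S x.1 x.2)%:E)%E.

(* Main.v *)
(* At radius rho > 0 the density of Area_g for the parametrisation by (t, phi)
   is exp(alpha - 2u) rho sqrt(rho'^2 + z'^2): the terms in A and B cancel in
   the Gram determinant. The gradient of rho is
   exp(2u - 2alpha) (d/drho - B d/dphi), of norm exp(u - alpha), and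
   |eta| = rho exp(-u), so area enlarging means alpha - 2u >= 0. On the axis
   both densities vanish, so the inequality holds pointwise. *)
Require Import Defs.
From mathcomp Require Import all_boot all_order all_algebra.
From mathcomp Require Import all_classical all_reals all_analysis.
From mathcomp Require Import ring lra.
Set Implicit Arguments.
Unset Strict Implicit.
Unset Printing Implicit Defensive.
Import Order.TTheory GRing.Theory Num.Theory numFieldNormedType.Exports.
Import HBNNSimple.
Local Open Scope classical_set_scope.
Local Open Scope ring_scope.

(** Polarization: [axisym_line_element] gives only the quadratic form, while Gram determinants and
    gradients also need mixed products. *)
Lemma bilin_polar (R : realType) (n : nat) (G : 'M[R]_n) (v w : 'rV[R]_n) :
  G^T = G ->
  bilin G v w =
  (bilin G (v + w) (v + w) - bilin G v v - bilin G w w) / 2.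
Proof.
move=> GT.
have sym : (w *m G *m v^T) 0 0 = (v *m G *m w^T) 0 0.
  by rewrite -[in LHS]GT -[in LHS](trmxK w) -!trmx_mul mulmxA mxE.
rewrite /bilin linearD /= mulmxDl mulmxDl !mulmxDr.
move: sym; rewrite !mxE => ->.
by field.
Qed.

Lemma cyl_vecD (R : realType) (rho phi a b c a' b' c' : R) :
  cyl_vec rho phi a b c + cyl_vec rho phi a' b' c' =
  cyl_vec rho phi (a + a') (b + b') (c + c').
Proof. by apply/rowP => -[[|[|[|//]]] hi]; rewrite !mxE /=; ring. Qed.

Lemma axisym_bilin (R : realType) (g : axisym_metric R)
    (rho z phi a b c a' b' c' : R) : 0 < rho ->
  bilin (g (cyl rho z phi)) (cyl_vec rho phi a b c) (cyl_vec rho phi a' b' c') =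
  expR (2 * m_alpha g rho z - 2 * m_u g rho z) * (a * a' + b * b')
  + rho ^+ 2 * expR (- 2 * m_u g rho z)
    * (c + m_B g rho z * a + m_A g rho z * b)
    * (c' + m_B g rho z * a' + m_A g rho z * b').
Proof.
move=> rho0; rewrite bilin_polar; last exact: Defs.metric_sym.
by rewrite cyl_vecD !axisym_line_element//; field.
Qed.

(** A nonzero row [v] of the left kernel of [g p] would satisfy [bilin (g p) v v = 0], against
    positivity. *)
Lemma metric_unit (R : realType) (n : nat) (g : riemannian_metric R n) p :
  g p \in unitmx.
Proof.
rewrite -row_free_unit -kermx_eq0; apply/eqP/row_matrixP => i.
rewrite row0; apply/eqP/negPn/negP => /(@Defs.metric_pos _ _ g p).
have /sub_kermxP k0 := row_sub i (kermx (g p)).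
by rewrite /bilin k0 mul0mx mxE ltxx.
Qed.

(** Lets a candidate gradient be checked by duality on the standard basis, with no matrix inverse to
    compute. *)
Lemma gradient_eq (R : realType) (n : nat) (g : riemannian_metric R n)
    (f : 'rV[R]_n.+1 -> R) (p X : 'rV[R]_n.+1) :
  (forall i, bilin (g p) X (delta_mx 0 i) = partial i f p) ->
  gradient g f p = X.
Proof.
move=> h; rewrite /gradient -[RHS](mulmxK (metric_unit g p)); congr (_ *m _).
by apply/rowP => i; rewrite mxE -h /bilin trmx_delta -colE mxE.
Qed.

(** Turns a directional derivative into a one-variable one, to which the chain rule
    [is_derive1_comp] applies. *)
Lemma derive_line (R : realType) (n : nat) (f : 'rV[R]_n.+1 -> R)
    (p v : 'rV[R]_n.+1) : 'D_v f p = 'D_1 (fun s : R => f (s *: v + p)) 0.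
Proof.
rewrite /derive; set F := (X in lim (X @ _)); set G := (X in _ = lim (X @ _)).
suff -> : F = G by []; apply/funext => h.
by rewrite /F /G/= addr0 scale0r add0r /GRing.scale/= mulr1.
Qed.

Lemma partial_rho_fun (R : realType) (rho z phi : R) (i : 'I_3) : 0 < rho ->
  partial i (@rho_fun R) (cyl rho z phi) = [:: cos phi; sin phi; 0]`_i.
Proof.
move=> rho0; rewrite /partial derive_line.
set p := cyl rho z phi; set v : 'rV[R]_3 := delta_mx 0 i.
(* Squared distance to the axis along the line; [q 0 = rho ^+ 2 > 0] makes the square root
   differentiable there. *)
pose q (s : R) := (s * v 0 0 + p 0 0) ^+ 2 + (s * v 0 1 + p 0 1) ^+ 2.
rewrite (_ : (fun s : R => _) = Num.sqrt \o q); last first.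
  by apply/funext => s; rewrite /rho_fun /q /= !mxE.
have q0 : q 0 = rho ^+ 2.
  rewrite /q /p !mul0r !add0r !mxE /=.
  by rewrite !exprMn -mulrDr cos2Dsin2 mulr1.
have lin (j : 'I_3) :
    is_derive (0 : R) (1 : R) (fun s : R => s * v 0 j + p 0 j) (v 0 j).
  by apply: is_derive_eq; rewrite /GRing.scale /= ; ring.
have dq : is_derive (0 : R) (1 : R) q (2 * p 0 0 * v 0 0 + 2 * p 0 1 * v 0 1).
  have h0 := lin 0; have h1 := lin 1.
  by apply: is_derive_eq; rewrite /GRing.scale /=; ring.
have dsq : is_derive (q 0) (1 : R) (@Num.sqrt R) (2 * Num.sqrt (q 0))^-1.
  by apply: is_derive1_sqrt; rewrite q0 exprn_gt0.
have := is_derive1_comp dsq dq.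
rewrite q0 sqrtr_sqr gtr0_norm// => D; rewrite (@derive_val _ _ _ _ _ _ _ D).
have rn0 : rho != 0 by rewrite gt_eqF.
rewrite /p /v; case: i @v q q0 lin dq dsq D => [[|[|[|//]]] hi] /= *;
  rewrite !mxE /=; by field.
Qed.

(** The last component is chosen so that [dphi + B drho + A dz] vanishes on the vector; only the
    conformal factor remains in its products. *)
Lemma gradient_rho (R : realType) (g : axisym_metric R) (rho z phi : R) :
  0 < rho ->
  gradient g (@rho_fun R) (cyl rho z phi) =
  cyl_vec rho phi (expR (2 * m_u g rho z - 2 * m_alpha g rho z)) 0
    (- m_B g rho z * expR (2 * m_u g rho z - 2 * m_alpha g rho z)).
Proof.
move=> rho0; apply: gradient_eq => i; rewrite partial_rho_fun//.
(* [e], [b] and [c] hold the components of the Cartesian basis vectors in the cylindrical frame. *)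
set e := [:: cos phi; sin phi; 0].
pose c := [:: - sin phi / rho; cos phi / rho; 0]`_i.
pose b : R := [:: 0; 0; 1]`_i.
have -> : delta_mx 0 i = cyl_vec rho phi e`_i b c.
  have rn0 : rho != 0 by rewrite gt_eqF.
  have := cos2Dsin2 phi; rewrite /e /b /c => cs.
  case: i c b => [[|[|[|//]]] hi] /= c b;
    apply/rowP => -[[|[|[|//]]] hj]; rewrite !mxE /=;
    first [by field | by rewrite -[LHS]cs; field].
rewrite axisym_bilin//.
have E1 : expR (2 * m_alpha g rho z - 2 * m_u g rho z) *
    expR (2 * m_u g rho z - 2 * m_alpha g rho z) = 1.
  by rewrite -expRD -[RHS]expR0; congr expR; ring.
by rewrite mul0r addr0 mulrA E1; ring.
Qed.

Lemma area_enlarging_ge0 (R : realType) (g : axisym_metric R) (rho z : R) :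
  area_enlarging g -> 0 < rho -> 0 <= m_alpha g rho z - 2 * m_u g rho z.
Proof.
move=> /(_ rho z 0) + rho0 => /(_ rho0) /=.
rewrite gradient_rho// eta_cyl /Defs.gnorm !axisym_bilin//.
set u := m_u g rho z; set al := m_alpha g rho z.
(* Both squared norms are put in the form of perfect squares, so that [sqrtr_sqr] removes the
   roots. *)
rewrite (_ : _ + _ = (rho * expR (- u)) ^+ 2); last first.
  by rewrite exprMn -expRM_natl; rewrite (_ : 2%:R * - u = - 2 * u); ring.
rewrite (_ : _ + _ = expR (u - al) ^+ 2); last first.
  transitivity (expR (2 * al - 2 * u) * expR (2 * u - 2 * al)
    * expR (2 * u - 2 * al)); first by ring.
  by rewrite -!expRD -expRM_natl; congr expR; ring.
rewrite !sqrtr_sqr !ger0_norm ?mulr_ge0 ?expR_ge0 ?(ltW rho0)//.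
rewrite -mulrA -expRN -expRD ler_pMr// => h.
rewrite -expR0 ler_expR in h; lra.
Qed.

Lemma area_density_axisym (R : realType) (g : axisym_metric R)
    (S : C1_axisym_surface R) (t phi : R) : 0 < c_rho S t ->
  area_density g S t phi =
  Num.sqrt (expR (2 * (m_alpha g (c_rho S t) (c_z S t)
                       - 2 * m_u g (c_rho S t) (c_z S t)))
            * (c_rho S t ^+ 2 * (c_drho S t ^+ 2 + c_dz S t ^+ 2))).
Proof.
move=> rho0; rewrite /area_density !axisym_bilin//; congr Num.sqrt.
set u := m_u _ _ _; set al := m_alpha _ _ _.
have -> : expR (2 * (al - 2 * u)) = expR (2 * al - 2 * u) * expR (- 2 * u).
  by rewrite -expRD; congr expR; ring.
by ring.
Qed.

(** At radius zero the angular tangent vector is zero, so the Gram determinant vanishes for any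
    metric. *)
Lemma area_density_axis (R : realType) (g : riemannian_metric R 2)
    (S : C1_axisym_surface R) (t phi : R) : c_rho S t = 0 ->
  area_density g S t phi = 0.
Proof.
move=> rho0; rewrite /area_density /cyl_vec rho0 !mul0r oppr0.
have -> : vec3 0 0 0 = 0 :> 'rV[R]_3.
  by apply/rowP => -[[|[|[|//]]] hi]; rewrite !mxE.
have bilin0 G (v : 'rV[R]_3) : bilin G v 0 = 0.
  by rewrite /bilin trmx0 mulmx0 mxE.
by rewrite !scaler0 !scale0r !addr0 !bilin0 mulr0 expr0n subr0 sqrtr0.
Qed.

Lemma le_area_density (R : realType) (g : axisym_metric R)
    (S : C1_axisym_surface R) (t phi : R) :
  area_enlarging g -> t \in c_dom S ->
  area_density (flat_metric R) S t phi <= area_density g S t phi.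
Proof.
move=> ge /c_half_plane; rewrite le_eqVlt => /predU1P[/esym r0|r0].
  by rewrite !area_density_axis.
(* The flat metric has [m_alpha = m_u = 0], so only the exponential factors differ under the two
   roots. *)
rewrite !area_density_axisym//=; apply: ler_wsqrtr.
apply: ler_wpM2r; first by rewrite mulr_ge0 ?addr_ge0 ?sqr_ge0.
rewrite ler_expR; have := area_enlarging_ge0 (c_z S t) ge r0; lra.
Qed.

(* For nonnegative functions the integral is a supremum over the simple
   functions below, so no measurability is needed. *)
Lemma ge0_le_integral_nomeas (d : measure_display)
    (T : measurableType d) (R : realType)
    (mu : {measure set T -> \bar R}) (D : set T) (f1 f2 : T -> \bar R) :
  (forall x, D x -> 0 <= f1 x)%E -> (forall x, D x -> f1 x <= f2 x)%E ->
  (\int[mu]_(x in D) f1 x <= \int[mu]_(x in D) f2 x)%E.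
Proof.
move=> f10 f12; have f20 x : D x -> (0 <= f2 x)%E.
  by move=> Dx; exact: le_trans (f10 _ Dx) (f12 _ Dx).
rewrite !ge0_integralE//; apply: le_ereal_sup => _ [h /= hf <-].
by exists h => // x; apply: le_trans (hf x) _; exact: lee_restrict.
Qed.

Theorem proposition5p4 (R : realType) (g : axisym_metric R)
    (Sigma : C1_axisym_surface R) :
  area_enlarging g -> (area (flat_metric R) Sigma <= area g Sigma)%E.
Proof.
move=> ge; apply: ge0_le_integral_nomeas => -[t phi] [/= tI _].
  by rewrite lee_fin sqrtr_ge0.
by rewrite lee_fin; exact: le_area_density.
Qed.
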